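(* Let $x_0,\dots,x_m\in\mathbb{C}^n$, let $X=[x_0\ \cdots\ x_{m-1}]$, $Y=[x_1\ \cdots\ x_m]\in\mathbb{C}^{n\times m}$ and $r=\operatorname{rank}(X)$. Let DMD eigenvalues $\lambda_1,\dots,\lambda_r$ (all $r$ eigenvalues of the DMD matrix, all non-zero), DMD modes $\vartheta_1,\dots,\vartheta_r$, DMD amplitudes $a_1,\dots,a_r$ and the error scaling $a_0$ be given by Exact Dynamic Mode Decomposition (EXDMD) applied to $x_0,\dots,x_m$. If $\ker(X)\subseteq\ker(Y)$ and the DMD eigenvalues $\lambda_1,\dots,\lambda_r$ are distinct, then $$x_0=\sum_{j=1}^r a_j\vartheta_j+q_0,\qquad x_k=\sum_{j=1}^r\lambda_j^k a_j\vartheta_j\quad (k=1,\dots,m),$$ where the vector $q_0\in\mathbb{C}^n$ satisfies $q_0=a_0\cdot q$ if $r=m$, and $q_0=0$ if $r\neq m$, with $q=x_m-Xc$ and $c=X^+x_m$.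
   Context: $M^+$ denotes the Moore-Penrose pseudoinverse and $M^*$ the conjugate transpose of a matrix $M$. EXDMD applied to data $x_0,\dots,x_m\in\mathbb{C}^n$: with $X=[x_0\ \cdots\ x_{m-1}]$, $Y=[x_1\ \cdots\ x_m]$ and $r=\operatorname{rank}(X)$, take a reduced singular value decomposition $X=U\Sigma V^*$ ($U\in\mathbb{C}^{n\times r}$ and $V\in\mathbb{C}^{m\times r}$ with orthonormal columns, $\Sigma\in\mathbb{R}^{r\times r}$ diagonal with positive diagonal entries). The DMD matrix is $S=U^*YV\Sigma^{-1}\in\mathbb{C}^{r\times r}$. The DMD eigenvalues are the non-zero eigenvalues $\lambda_i$ of $S$, with chosen eigenvectors $v_i$ ($Sv_i=\lambda_iv_i$, $v_i\ne0$). The DMD modes are $\vartheta_i=\frac1{\lambda_i}YV\Sigma^{-1}v_i\in\mathbb{C}^n$. In the case considered here all $r$ eigenvalues of $S$ are non-zero, so $i=1,\dots,r$. Put $\Theta=[\vartheta_1\ \cdots\ \vartheta_r]$ and $\Lambda=\operatorname{diag}(\lambda_1,\dots,\lambda_r)$. The DMD amplitudes are the entries of $a=(a_1,\dots,a_r)^T=\Lambda^{-1}\Theta^+x_1$. For distinct $\lambda_1,\dots,\lambda_r$ the error scaling is $$a_0=-\sum_{j=1}^{r}\frac1{\lambda_j}\prod_{\substack{k=1\\k\ne j}}^{r}\frac1{\lambda_j-\lambda_k}.$$ *)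

(* Defs.v *)
From mathcomp Require Export all_boot all_order all_algebra.
From mathcomp Require Export complex.
From mathcomp Require Export reals.

Set Implicit Arguments.
Unset Strict Implicit.
Unset Printing Implicit Defensive.

Import Order.TTheory GRing.Theory Num.Theory.
Local Open Scope ring_scope.
Local Open Scope sesquilinear_scope.
Local Open Scope complex_scope.

Section MoorePenrose.
Variable C : numClosedFieldType.

(* The four Penrose equations; [M^t*] is the conjugate transpose. *)
Definition is_moore_penrose p q (M : 'M[C]_(p, q)) (P : 'M[C]_(q, p)) : bool :=
  [&& M *m P *m M == M, P *m M *m P == P,
      (M *m P)^t* == M *m P & (P *m M)^t* == P *m M].

Lemma adjmx_mul p q s (A : 'M[C]_(p, q)) (B : 'M[C]_(q, s)) :
  (A *m B)^t* = B^t* *m A^t*.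
Proof. by rewrite trmx_mul map_mxM. Qed.

Lemma mulmx_adj_eq0 p q (A : 'M[C]_(p, q)) : A *m A^t* = 0 -> A = 0.
Proof.
move=> A0; apply/matrixP=> i j; rewrite mxE.
have := congr1 (fun B : 'M[C]_p => B i i) A0; rewrite !mxE => /eqP.
have F k : A i k * (A^t*) k i = `|A i k| ^+ 2 by rewrite !mxE normCK.
rewrite (eq_bigr _ (fun k _ => F k)) psumr_eq0; last first.
  by move=> k _; rewrite exprn_ge0.
by move/allP/(_ j (mem_index_enum _)); rewrite /= expf_eq0 /= normr_eq0 => /eqP.
Qed.

Lemma row_free_gram_unit p q (A : 'M[C]_(p, q)) :
  row_free A -> A *m A^t* \in unitmx.
Proof.
move=> fA; rewrite -row_free_unit -kermx_eq0; apply/eqP.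
set K := kermx _; have K0 : K *m (A *m A^t*) = 0 by exact: mulmx_ker.
have KA0 : K *m A = 0.
  by apply: mulmx_adj_eq0; rewrite adjmx_mul !mulmxA -(mulmxA K) K0 mul0mx.
by apply: (row_free_inj fA); rewrite KA0 mul0mx.
Qed.

Lemma moore_penrose_exists p q (M : 'M[C]_(p, q)) :
  exists P, is_moore_penrose M P.
Proof.
have [s [B [A [MBA fA fB]]]] : exists s (B : 'M[C]_(p, s)) (A : 'M[C]_(s, q)),
    [/\ M = B *m A, row_free A & row_free (B^t*)].
  exists (\rank M), (col_base M), (row_base M).
  split; [by rewrite mulmx_base | exact: row_base_free |].
  by rewrite /row_free mxrank_map mxrank_tr (eqP (col_base_full M)).
have uA : A *m A^t* \in unitmx by exact: row_free_gram_unit.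
have uB : B^t* *m B \in unitmx.
  by have := row_free_gram_unit fB; rewrite trmxCK.
pose A' := A^t* *m invmx (A *m A^t*); pose B' := invmx (B^t* *m B) *m B^t*.
have AA' : A *m A' = 1%:M by rewrite /A' mulmxA mulmxV.
have B'B : B' *m B = 1%:M by rewrite /B' -mulmxA mulVmx.
have hinv (G : 'M[C]_s) : G \in unitmx -> G^t* = G -> (invmx G)^t* = invmx G.
  by move=> uG GE; rewrite trmx_inv map_invmx GE.
exists (A' *m B').
have MP : M *m (A' *m B') = B *m B'.
  by rewrite MBA mulmxA -(mulmxA B) AA' mulmx1.
have PM : A' *m B' *m M = A' *m A.
  by rewrite MBA mulmxA -(mulmxA A') B'B mulmx1.
rewrite /is_moore_penrose MP PM; apply/and4P; split; apply/eqP.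
- by rewrite MBA mulmxA -(mulmxA B) B'B mulmx1.
- by rewrite mulmxA -(mulmxA A') AA' mulmx1.
- by rewrite /B' !adjmx_mul trmxCK hinv ?adjmx_mul ?trmxCK ?mulmxA.
- by rewrite /A' !adjmx_mul trmxCK hinv ?adjmx_mul ?trmxCK ?mulmxA.
Qed.

Definition pinv p q (M : 'M[C]_(p, q)) : 'M[C]_(q, p) :=
  xchoose (moore_penrose_exists M).

Lemma pinvP p q (M : 'M[C]_(p, q)) : is_moore_penrose M (pinv M).
Proof. exact: xchooseP. Qed.

Lemma moore_penrose_uniq p q (M : 'M[C]_(p, q)) (P Q : 'M[C]_(q, p)) :
  is_moore_penrose M P -> is_moore_penrose M Q -> P = Q.
Proof.
case/and4P=> /eqP P1 /eqP P2 /eqP P3 /eqP P4.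
case/and4P=> /eqP Q1 /eqP Q2 /eqP Q3 /eqP Q4.
have E1 : M *m P = M *m Q.
  by rewrite -{1}Q1 -(mulmxA (M *m Q)) -Q3 -P3 -adjmx_mul mulmxA P1 Q3.
have E2 : P *m M = Q *m M.
  by rewrite -{1}Q1 -(mulmxA M) mulmxA -P4 -Q4 -adjmx_mul -mulmxA (mulmxA M) P1 Q4.
by rewrite -P2 -mulmxA E1 mulmxA E2 Q2.
Qed.

End MoorePenrose.

Section ExactDMD.
Variables (R : realType) (n m r : nat).
Implicit Types (x : 'I_m.+1 -> 'cV[R[i]]_n) (X Y : 'M[R[i]]_(n, m)).
Implicit Types (U : 'M[R[i]]_(n, r)) (sigma : 'rV[R]_r) (V : 'M[R[i]]_(m, r)).
Implicit Types (lambda : 'I_r -> R[i]) (v : 'I_r -> 'cV[R[i]]_r).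

Definition snapshotsX x : 'M[R[i]]_(n, m) :=
  \matrix_(i, j) x (widen_ord (leqnSn m) j) i 0.

Definition snapshotsY x : 'M[R[i]]_(n, m) :=
  \matrix_(i, j) x (lift ord0 j) i 0.

Definition Sigma_mx sigma : 'M[R[i]]_r := diag_mx (map_mx (real_complex R) sigma).

Record reduced_svd X U sigma V : Prop := ReducedSVD {
  svd_rank : r = \rank X;
  svd_U : U^t* *m U = 1%:M;
  svd_V : V^t* *m V = 1%:M;
  svd_pos : forall i, 0 < sigma 0 i;
  svd_eq : X = U *m Sigma_mx sigma *m V^t*
}.

Definition dmd_matrix Y U sigma V : 'M[R[i]]_r :=
  U^t* *m Y *m V *m invmx (Sigma_mx sigma).

(* [lambda] lists all [r] eigenvalues of the DMD matrix (with multiplicity, as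
   the roots of its characteristic polynomial), none of them zero, and [v]
   the chosen eigenvectors. *)
Record exdmd x U sigma V lambda v : Prop := ExDMD {
  exdmd_svd : reduced_svd (snapshotsX x) U sigma V;
  exdmd_spectrum : char_poly (dmd_matrix (snapshotsY x) U sigma V) =
                   \prod_(i < r) ('X - (lambda i)%:P);
  exdmd_eigen_neq0 : forall i, lambda i != 0;
  exdmd_eigenvector : forall i,
    dmd_matrix (snapshotsY x) U sigma V *m v i = lambda i *: v i;
  exdmd_eigenvector_neq0 : forall i, v i != 0
}.

Definition dmd_mode x sigma V lambda v (i : 'I_r) : 'cV[R[i]]_n :=
  (lambda i)^-1 *: (snapshotsY x *m V *m invmx (Sigma_mx sigma) *m v i).

Definition dmd_modes_mx x sigma V lambda v : 'M[R[i]]_(n, r) :=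
  \matrix_(i, j) dmd_mode x sigma V lambda v j i 0.

(* [inord 1] is the index [1] as soon as [0 < m]. *)
Definition dmd_amplitudes x sigma V lambda v : 'cV[R[i]]_r :=
  invmx (diag_mx (\row_j lambda j)) *m pinv (dmd_modes_mx x sigma V lambda v)
    *m x (inord 1).

Definition error_scaling lambda : R[i] :=
  - \sum_(j < r) ((lambda j)^-1 *
      \prod_(k < r | k != j) (lambda j - lambda k)^-1).

End ExactDMD.

(* Main.v *)
Require Import Defs.
From mathcomp Require Import zify.

(** The matrix [A = Y V Sigma^-1 U^*] advances the snapshots one
    step: [Y = Y V V^*] because [ker X] is contained in [ker Y], and hence
    [A X = Y].  The modes are eigenvectors of [A], with [U^* theta_j = v_j], and
    they span the range of [Y] because the [v_j], belonging to distinct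
    eigenvalues, form a basis.  As the first snapshot after the initial one
    lies in that range, the pseudoinverse in the definition of the amplitudes
    expands it exactly in the modes, and applying [A] repeatedly gives the
    expansion of all later snapshots.

    What remains is the defect [q0 = x_0 - sum_j a_j theta_j].  It satisfies
    [A q0 = 0]; applying [U^*] gives [S (U^* q0) = 0], hence [U^* q0 = 0] since
    the DMD matrix [S] is invertible.  So the projection [P = 1 - U U^*] fixes [q0],
    while it kills [x_0, ..., x_(m-1)], which lie in the range of [X].  Let
    [p = prod_j ('X - lambda_j)].  Since [p] vanishes at every [lambda_j],
    [sum_k p_k (sum_j lambda_j^k a_j theta_j) = 0]; applying [P] leaves only the
    term [k = 0], equal to [- p_0 q0], and the term [k = r] if [r = m], equal to
    [P x_m] ([exponential_sum_defect]).  Since [p_0 <> 0], this gives [q0 = 0]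
    when [r < m].  When [r = m], it gives [q0 = p_0^-1 P x_m], where
    [P x_m = q] because [X X^+ = U U^*] ([svd_mul_pinv]), and
    [p_0^-1] is the error scaling by the partial fraction expansion of [1 / p]
    at [0] ([error_scalingE]). *)

Set Implicit Arguments.
Unset Strict Implicit.

Import Order.TTheory GRing.Theory Num.Theory.
Local Open Scope ring_scope.
Local Open Scope complex_scope.
Local Open Scope sesquilinear_scope.

(** * Polynomials with prescribed roots *)

(** The Lagrange interpolant of the constant [1] at [r > 0] nodes: both sides
    have degree less than [r] and agree at [r] distinct points. *)
Lemma lagrange_basis_sum1 (F : fieldType) (r : nat) (l : 'I_r -> F) :
  (0 < r)%N -> injective l ->
  \sum_(j < r) (\prod_(k < r | k != j) (l j - l k)^-1) *:
    \prod_(k < r | k != j) ('X - (l k)%:P) = 1.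
Proof.
move=> r_gt0 l_inj; apply/eqP; rewrite -subr_eq0; apply/eqP.
have size_basis j : size (\prod_(k < r | k != j) ('X - (l k)%:P)) = r.
  rewrite size_prod => [|k _]; last by rewrite polyXsubC_eq0.
  under eq_bigr do rewrite size_XsubC.
  by rewrite sum_nat_const (cardC1 j) card_ord; lia.
apply: (@roots_geq_poly_eq0 _ _ [seq l j | j <- enum 'I_r]).
- apply/allP=> _ /mapP[i _ ->]; rewrite rootE !hornerE horner_sum (bigD1 i) //=.
  rewrite hornerZ horner_prod -big_split /= big1 => [|k ki]; last first.
    by rewrite !hornerE mulVf // subr_eq0 (inj_eq l_inj) eq_sym.
  rewrite big1 ?addr0 ?subrr // => j ji.
  rewrite hornerZ horner_prod [X in _ * X](bigD1 i) 1?eq_sym //= !hornerE subrr.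
  by rewrite /= mulr0 mul0r.
- by rewrite map_inj_uniq ?enum_uniq.
- rewrite size_map size_enum_ord (leq_trans (size_polyD _ _)) // geq_max.
  rewrite size_polyN size_poly1 r_gt0 andbT.
  apply: (leq_trans (size_sum _ _ _)); apply/bigmax_leqP => j _.
  by rewrite (leq_trans (size_scale_leq _ _)) ?size_basis.
Qed.

(** Evaluating [lagrange_basis_sum1] at [0] and dividing by the product of the
    [- l k], that is, the partial fraction expansion of the inverse of
    [\prod_k ('X - l k)] at [0]. *)
Lemma error_scalingE (R : realType) (r : nat) (l : 'I_r -> R[i]) :
  (0 < r)%N -> injective l -> (forall j, l j != 0) ->
  error_scaling l = (\prod_(k < r) - l k)^-1.
Proof.
move=> r_gt0 l_inj l_neq0.
have p_neq0 : \prod_(k < r) - l k != 0.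
  by apply/prodf_neq0 => k _; rewrite oppr_eq0.
apply: (mulIf p_neq0); rewrite mulVf //.
have := congr1 (horner^~ 0) (lagrange_basis_sum1 r_gt0 l_inj).
rewrite horner_sum -[X in _ = X -> _]/(1%:P.[0]) hornerC => sum1.
rewrite -[RHS]sum1 /error_scaling mulNr mulr_suml -sumrN; apply: eq_bigr => j _.
rewrite [X in _ * X](bigD1 j) //= hornerZ horner_prod.
under [X in _ = _ * X]eq_bigr do rewrite hornerXsubC sub0r.
by rewrite mulNr mulrN opprK mulrACA mulVf // mul1r.
Qed.

(** If a sequence is an exponential sum with rates [l] except at index [0],
    then the coefficients of [p = \prod_k ('X - l k)] form a linear recurrence
    that the exponential sum satisfies at index [0] too.  The map [P]
    cancels the inner terms of this recurrence, so only the constant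
    coefficient and, when [r = m], the leading one contribute. *)
Lemma exponential_sum_defect (F : fieldType) (n m r : nat) (l : 'I_r -> F)
    (b : 'I_r -> 'cV[F]_n) (x : nat -> 'cV[F]_n) (P : 'M[F]_n) :
  let q0 := x 0%N - \sum_(j < r) b j in
  (0 < m)%N -> (r <= m)%N ->
  (forall k, (0 < k <= m)%N -> x k = \sum_(j < r) l j ^+ k *: b j) ->
  (forall k, (k < m)%N -> P *m x k = 0) -> P *m q0 = q0 ->
  (\prod_(k < r) - l k) *: q0 = if r == m then P *m x m else 0.
Proof.
move=> q0 m_gt0 le_rm xE Px Pq0.
pose p := \prod_(k < r) ('X - (l k)%:P).
have size_p : size p = r.+1.
  by rewrite size_prod_XsubC [index_enum _]unlock -enumT size_enum_ord.
have p0 : p`_0 = \prod_(k < r) - l k.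
  rewrite -horner_coef0 horner_prod; apply: eq_bigr => k _.
  by rewrite hornerXsubC sub0r.
have pr : p`_r = 1.
  by have /monicP := monic_prod_XsubC (index_enum 'I_r) xpredT l;
    rewrite lead_coefE size_p.
have psum : \sum_(k < r.+1) p`_k *: \sum_(j < r) l j ^+ k *: b j = 0.
  under eq_bigr do rewrite scaler_sumr.
  rewrite exchange_big big1 // => j _.
  under eq_bigr do rewrite scalerA.
  rewrite -scaler_suml -horner_coef_wide ?size_p // horner_prod (bigD1 j) //=.
  by rewrite !hornerE subrr mul0r scale0r.
have Pb : P *m (\sum_(j < r) b j) = - q0.
  have : \sum_(j < r) b j = x 0%N - q0 by rewrite /q0 opprB addrC subrK.
  by move=> ->; rewrite mulmxBr Px // Pq0 sub0r.
have := congr1 (mulmx P) psum; rewrite mulmx0 big_ord_recl mulmxDr /=.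
under eq_bigr do rewrite expr0 scale1r.
rewrite -scalemxAr Pb scalerN p0 => /eqP; rewrite addrC subr_eq0 => /eqP <-.
rewrite mulmx_sumr.
have step (k : 'I_r) :
    P *m (p`_(bump 0 k) *: \sum_(j < r) l j ^+ bump 0 k *: b j) =
    p`_k.+1 *: (P *m x k.+1).
  by rewrite -scalemxAr -xE //= (leq_trans (ltn_ord k)).
under eq_bigr do rewrite step.
case: eqP => [rm | /eqP rm]; last first.
  rewrite big1 // => k _; rewrite Px ?scaler0 //.
  by have := ltn_ord k; lia.
(* Here [r = m > 0], and the last term [k = r - 1] is the one in [x m]. *)
case: r rm l b q0 le_rm xE Pq0 p size_p p0 pr psum Pb step => [|r'] rm l b q0;
  first by lia.
move=> _ _ _ p _ _ pr _ _ _.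
rewrite big_ord_recr /= pr scale1r rm big1 ?add0r // => k _.
by rewrite Px ?scaler0 //; have := ltn_ord k; lia.
Qed.

(** * Linear algebra behind the dynamic mode decomposition *)

(** In a vanishing combination of the [v i], each term lies in its own
    eigenspace, and the eigenspaces of distinct eigenvalues are in direct sum.
    The transposes bring this to the row vectors of [eigenspace]. *)
Lemma eigenvectors_unit (F : fieldType) (r : nat) (S : 'M[F]_r)
    (l : 'I_r -> F) (v : 'I_r -> 'cV[F]_r) :
  injective l -> (forall i, S *m v i = l i *: v i) -> (forall i, v i != 0) ->
  \matrix_(i, j) v j i 0 \in unitmx.
Proof.
move=> l_inj Sv v_neq0; rewrite -unitmx_tr -row_free_unit.
set W := _^T.
have rowW i : row i W = (v i)^T by apply/matrixP=> a b; rewrite !mxE ord1.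
have eigW i : (row i W <= eigenspace S^T (l i))%MS.
  by apply/eigenspaceP; rewrite rowW -trmx_mul Sv linearZ.
have dx : mxdirect (\sum_(i < r) eigenspace S^T (l i)).
  by apply: mxdirect_sum_eigenspace => i j _ _; apply: l_inj.
rewrite -kermx_eq0; apply/rowV0P=> b /sub_kermxP bW; apply/rowP=> i.
have := bW; rewrite mulmx_sum_row (bigD1 i) //= => /eqP.
rewrite addr_eq0 => /eqP bWi.
have : (b 0 i *: row i W <=
    eigenspace S^T (l i) :&:
      \sum_(j < r | true && (j != i)) eigenspace S^T (l j))%MS.
  rewrite sub_capmx scalemx_sub //= bWi eqmx_opp summx_sub // => j ji.
  by rewrite scalemx_sub // (sumsmx_sup j).
rewrite (mxdirect_sumsP dx) // submx0 scaler_eq0 rowW => /orP[/eqP ->|].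
  by rewrite mxE.
by rewrite trmx_eq0 (negPf (v_neq0 i)).
Qed.

Lemma mulmx_cols (F : comPzRingType) (n r : nat) (f : 'I_r -> 'cV[F]_n)
    (w : 'cV[F]_r) :
  (\matrix_(i, j) f j i 0) *m w = \sum_(j < r) w j 0 *: f j.
Proof.
apply/colP=> i; rewrite summxE mxE; apply: eq_bigr => j _.
by rewrite !mxE mulrC.
Qed.

Section Svd.
Context (C : numClosedFieldType) (n m r : nat).
Context (X : 'M[C]_(n, m)) (U : 'M[C]_(n, r)) (D : 'M[C]_r) (V : 'M[C]_(m, r)).
Hypotheses (UU : U^t* *m U = 1%:M) (VV : V^t* *m V = 1%:M).
Hypotheses (D_unit : D \in unitmx) (X_svd : X = U *m D *m V^t*).

(** Both sides are the orthogonal projection on the range of [X]: each fixes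
    the range of the other, and taking adjoints turns this into equality. *)
Lemma svd_mul_pinv : X *m pinv X = U *m U^t*.
Proof.
case/and4P: (pinvP X) => /eqP XPX _ /eqP XPadj _.
have UE : U = X *m (V *m invmx D).
  by rewrite X_svd mulmxA -(mulmxA (U *m D)) VV mulmx1 mulmxK.
have XPU : X *m pinv X *m U = U by rewrite {1}UE mulmxA XPX -UE.
have UUX : U *m U^t* *m X = X.
  by rewrite {1}X_svd -!mulmxA (mulmxA (U^t*)) UU mul1mx !mulmxA -X_svd.
have : U *m U^t* *m (X *m pinv X) = X *m pinv X by rewrite mulmxA UUX.
move/(congr1 (fun M : 'M_n => M^t*)).
by rewrite adjmx_mul XPadj adjmx_mul trmxCK mulmxA XPU.
Qed.

(** [1 - V V^*] maps into the kernel of [X], hence into that of [Y]. *)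
Lemma ker_sub_svd p (Y : 'M[C]_(p, m)) :
  (forall w : 'cV_m, X *m w = 0 -> Y *m w = 0) -> Y = Y *m V *m V^t*.
Proof.
move=> kerXY; apply/eqP; rewrite -subr_eq0; apply/eqP.
have -> : Y - Y *m V *m V^t* = Y *m (1%:M - V *m V^t*).
  by rewrite mulmxBr mulmx1 mulmxA.
apply/row_matrixP=> i; apply/rowP=> j; rewrite row0 mxE.
have X0 : X *m (1%:M - V *m V^t*) = 0.
  by rewrite mulmxBr mulmx1 X_svd mulmxA -(mulmxA _ (V^t*)) VV mulmx1 subrr.
have := kerXY (col j (1%:M - V *m V^t*)).
rewrite colE !mulmxA X0 mul0mx => /(_ erefl) /matrixP/(_ i 0).
by rewrite -colE !mxE.
Qed.
End Svd.

(** * The decomposition of the snapshots *)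

Theorem theorem6p3 (R : realType) (n m r : nat) (m_gt0 : (0 < m)%N)
  (x : 'I_m.+1 -> 'cV[R[i]]_n)
  (U : 'M[R[i]]_(n, r)) (sigma : 'rV[R]_r) (V : 'M[R[i]]_(m, r))
  (lambda : 'I_r -> R[i]) (v : 'I_r -> 'cV[R[i]]_r)
  (Hdmd : exdmd x U sigma V lambda v)
  (Hker : forall w : 'cV[R[i]]_m, snapshotsX x *m w = 0 -> snapshotsY x *m w = 0)
  (Hdistinct : injective lambda) :
  let X := snapshotsX x in
  let theta := dmd_mode x sigma V lambda v in
  let a := dmd_amplitudes x sigma V lambda v in
  let a0 := error_scaling lambda in
  let c := pinv X *m x ord_max in
  let q := x ord_max - X *m c in
  exists q0 : 'cV[R[i]]_n,
    [/\ x ord0 = \sum_(j < r) a j 0 *: theta j + q0,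
        forall k : 'I_m.+1, (0 < k)%N ->
          x k = \sum_(j < r) (lambda j ^+ k * a j 0) *: theta j,
        r = m -> q0 = a0 *: q
      & r <> m -> q0 = 0].
Proof.
case: Hdmd => [[rk UU VV sigma_gt0 X_svd] _ l_neq0 Sv v_neq0] X theta a a0 c q.
set Y := snapshotsY x in Sv.
pose D := Sigma_mx sigma; pose B := Y *m V *m invmx D; pose A := B *m U^t*.
pose S := dmd_matrix Y U sigma V.
have D_unit : D \in unitmx.
  rewrite unitmxE det_diag unitfE; apply/prodf_neq0 => i _.
  by rewrite !mxE fmorph_eq0 gt_eqF.
have SE : S = U^t* *m B by rewrite /S /dmd_matrix /B !mulmxA.
have x_colX k (lt_km : (k < m)%N) : x (inord k) = col (Ordinal lt_km) X.
  apply/colP=> i; rewrite !mxE; congr (x _ i 0); apply: val_inj => /=.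
  by rewrite inordK // ltnW.
have AX : A *m X = Y.
  rewrite /A /B /X X_svd -/D -!mulmxA (mulmxA (U^t*)) UU mul1mx mulKmx // mulmxA.
  by rewrite -(ker_sub_svd VV X_svd Hker).
have Ax (k : nat) : (k < m)%N -> A *m x (inord k) = x (inord k.+1).
  move=> lt_km; rewrite (x_colX k lt_km).
  have -> : x (inord k.+1) = col (Ordinal lt_km) Y.
    apply/colP=> i; rewrite !mxE; congr (x _ i 0); apply: val_inj.
    by rewrite /= inordK.
  by rewrite -AX !colE mulmxA.
have thetaE j : B *m v j = lambda j *: theta j.
  by rewrite /theta /dmd_mode scalerA divff // scale1r.
have Utheta j : U^t* *m theta j = v j.
  by rewrite -scalemxAr mulmxA -SE Sv scalerA mulVf // scale1r.
have Atheta j : A *m theta j = lambda j *: theta j by rewrite -mulmxA Utheta.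
pose W : 'M_r := \matrix_(i, j) v j i 0; pose L := diag_mx (\row_j lambda j).
have W_unit : W \in unitmx by apply: (@eigenvectors_unit _ _ S lambda).
have L_unit : L \in unitmx.
  by rewrite unitmxE det_diag unitfE; apply/prodf_neq0 => i _; rewrite mxE.
have SW : S *m W = W *m L.
  apply/matrixP=> i j; have := congr1 (fun u : 'cV_r => u i 0) (Sv j).
  rewrite mul_mx_diag !mxE mulrC => <-.
  by apply: eq_bigr => k _; rewrite !mxE.
have S_unit : S \in unitmx.
  have : S *m W \in unitmx by rewrite SW unitmx_mul W_unit.
  by rewrite unitmx_mul => /andP[].
pose Theta := dmd_modes_mx x sigma V lambda v.
have ThetaL : Theta *m L = B *m W.
  apply/matrixP=> i j; have := congr1 (fun u : 'cV_n => u i 0) (thetaE j).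
  rewrite mul_mx_diag !mxE mulrC => <-.
  by apply: eq_bigr => k _; rewrite !mxE.
have Theta_cols w : Theta *m w = \sum_(j < r) w j 0 *: theta j.
  by apply: mulmx_cols.
have BE : B = Theta *m (L *m invmx W) by rewrite mulmxA ThetaL mulmxK.
(* Keeps the rewriting below from unfolding the products inside [theta], [B]. *)
clearbody theta B.
(* [x_1 = A x_0] is in the range of [Theta], on which [Theta Theta^+] is the
   identity. *)
have x1E : x (inord 1) = \sum_(j < r) lambda j ^+ 1 *: (a j 0 *: theta j).
  have -> : \sum_(j < r) lambda j ^+ 1 *: (a j 0 *: theta j) = Theta *m (L *m a).
    rewrite Theta_cols; apply: eq_bigr => j _.
    by rewrite mul_diag_mx !mxE expr1 scalerA.
  have Lx : L *m a = pinv Theta *m x (inord 1).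
    by rewrite /a /dmd_amplitudes -mulmxA mulKVmx.
  rewrite Lx -(Ax 0%N) // /A BE -!mulmxA.
  by case/and4P: (pinvP Theta) => /eqP + _ _ _; rewrite !mulmxA => ->.
have xkE k : (0 < k <= m)%N ->
    x (inord k) = \sum_(j < r) lambda j ^+ k *: (a j 0 *: theta j).
  elim: k => // -[|k] IH // lt_km.
  rewrite -Ax // IH ?mulmx_sumr; last by rewrite /= ltnW.
  apply: eq_bigr => j _.
  by rewrite -2!scalemxAr Atheta !scalerA [in RHS]exprSr -!mulrA (mulrC (a j 0)).
pose q0 := x (inord 0) - \sum_(j < r) a j 0 *: theta j.
pose P := 1%:M - U *m U^t*.
have Uq0 : U^t* *m q0 = 0.
  have : A *m q0 = 0.
    rewrite mulmxBr Ax // x1E mulmx_sumr -sumrB big1 // => j _.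
    by rewrite -scalemxAr Atheta !scalerA mulrC subrr.
  rewrite /A -mulmxA => /(congr1 (mulmx (U^t*))).
  rewrite mulmx0 !mulmxA -SE -mulmxA => /(congr1 (mulmx (invmx S))).
  by rewrite mulKmx // mulmx0.
have PX : P *m X = 0.
  by rewrite mulmxBl mul1mx /X {2}X_svd -!mulmxA (mulmxA (U^t*)) UU mul1mx
     !mulmxA -X_svd subrr.
have Px k : (k < m)%N -> P *m x (inord k) = 0.
  by move=> lt_km; rewrite (x_colX k lt_km) colE mulmxA PX mul0mx.
have le_rm : (r <= m)%N by rewrite rk rank_leq_col.
have defect : (\prod_(k < r) - lambda k) *: q0 =
    if r == m then P *m x (inord m) else 0.
  apply: (@exponential_sum_defect _ n m r lambda (fun j => a j 0 *: theta j)
           (fun k => x (inord k)) P) => //.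
  by rewrite -/q0 mulmxBl mul1mx -mulmxA Uq0 mulmx0 subr0.
have p_neq0 : \prod_(k < r) - lambda k != 0.
  by apply/prodf_neq0 => k _; rewrite oppr_eq0.
have inordE (k : 'I_m.+1) : inord k = k by apply: val_inj; rewrite /= inordK.
exists q0; split.
- by rewrite /q0 (inordE ord0) addrC subrK.
- move=> k k_gt0; have le_km : (k <= m)%N by rewrite -ltnS.
  rewrite -[in LHS](inordE k) xkE ?k_gt0 //.
  by apply: eq_bigr => j _; rewrite scalerA.
- move=> rm; move: defect; rewrite (introT eqP rm) => defect.
  have -> : q = P *m x (inord m).
    rewrite /q /c mulmxA (svd_mul_pinv UU VV D_unit X_svd).
    by rewrite (inordE ord_max) mulmxBl mul1mx.
  have r_gt0 : (0 < r)%N by rewrite rm.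
  by rewrite -defect /a0 error_scalingE // scalerA mulVf // scale1r.
- move=> /eqP/negPf rm; move/eqP: defect; rewrite rm scaler_eq0 (negPf p_neq0).
  by move/eqP.
Qed.
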